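(* For any integers $t\geq2$ and $j\geq0$, let $c_{j,t}(n)$ denote the number of partitions of $n$ that are generalized $(j,t)$-cores. Then \[ \sum_{n\geq0}c_{j,t}(n)q^n = \frac{\left(q^{t^{j+1}};q^{t^{j+1}}\right)_{\infty}^{t^{j+1}}}{(q)_{\infty}}. \]
   Context: Products: $(a;q)_\infty:=\prod_{k\ge0}(1-aq^k)$ and $(q)_\infty:=(q;q)_\infty=\prod_{k\geq1}(1-q^k)$; thus $(q^m;q^m)_\infty=\prod_{k\ge1}(1-q^{mk})$. The identity is between power series in $q$ (formal, or for $|q|<1$). Partitions: the empty partition $\emptyset$ is included, as the unique partition of $0$; $|\lambda|$ is the sum of the parts of $\lambda$. For a finite collection (tuple, counted with multiplicity) $X$ of partitions, $|X|$ is the sum of the sizes of the partitions in $X$. $t$-core and $t$-quotient: for $t\ge2$, a $t$-core is a partition none of whose hook lengths is divisible by $t$. The $t$-core $\lambda_{(t)}$ of $\lambda$ is the $t$-core obtained from $\lambda$ by successively removing (rim) hooks of length divisible by $t$ until none remain (the result is independent of choices). The $t$-quotient $\lambda^{(t)}$ is the standard $t$-tuple of partitions defined by the $t$-abacus: pick $N$ divisible by $t$ with $N$ at least the number of parts of $\lambda=(\lambda_1\ge\lambda_2\ge\dots)$ (padded with zeros), let $X=\{\lambda_i+N-i: 1\le i\le N\}$, and for $0\le r\le t-1$ let $X_r=\{x\ge0: tx+r\in X\}$; writing $X_r=\{x_1>x_2>\dots>x_m\}$, the $r$-th component of $\lambda^{(t)}$ is the partition with parts $x_i-(m-i)$, $1\le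 i\le m$ (zeros discarded). The map $\lambda\mapsto(\lambda_{(t)},\lambda^{(t)})$ is a bijection from partitions to pairs ($t$-core, $t$-tuple of partitions), and $|\lambda|=|\lambda_{(t)}|+t|\lambda^{(t)}|$. Pre-tower and generalized cores: set $\alpha_0(t;\lambda)=(\lambda)$, and for $j\ge1$ let $\alpha_j(t;\lambda)$ be the tuple of $t^j$ partitions obtained by taking, in order, the $t$-quotients of all the partitions in $\alpha_{j-1}(t;\lambda)$. A partition $\lambda$ is a generalized $(j,t)$-core if all the partitions in $\alpha_{j+1}(t;\lambda)$ are empty, i.e. $|\alpha_{j+1}(t;\lambda)|=0$. *)

(* Defs.v *)
From HB Require Import structures.
From mathcomp Require Import all_boot all_order all_algebra.
From mathcomp Require Import finmap boolp classical_sets functions cardinality.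

Set Implicit Arguments.
Unset Strict Implicit.
Unset Printing Implicit Defensive.

Import GRing.Theory.
Local Open Scope ring_scope.

(* The alias keeps the Cauchy product apart from the pointwise ring structure
   of [nat -> R]; the coefficient of q^n in F is F n. *)
Definition fps (R : Type) : Type := nat -> R.

HB.instance Definition _ (R : Type) := gen_eqMixin (fps R).
HB.instance Definition _ (R : Type) := gen_choiceMixin (fps R).

Section FormalPowerSeries.
Variable R : comUnitRingType.
Implicit Types F G H : fps R.

Definition fps_zero : fps R := fun=> 0.
Definition fps_opp F : fps R := fun n => - F n.
Definition fps_add F G : fps R := fun n => F n + G n.

Lemma fps_addA : associative fps_add.
Proof. by move=> F G H; apply/funext => n; exact: addrA. Qed.
Lemma fps_addC : commutative fps_add.
Proof. by move=> F G; apply/funext => n; exact: addrC. Qed.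
Lemma fps_add0 : left_id fps_zero fps_add.
Proof. by move=> F; apply/funext => n; exact: add0r. Qed.
Lemma fps_addN : left_inverse fps_zero fps_opp fps_add.
Proof. by move=> F; apply/funext => n; exact: addNr. Qed.

HB.instance Definition _ :=
  GRing.isZmodule.Build (fps R) fps_addA fps_addC fps_add0 fps_addN.

Definition fps_one : fps R := fun n => (n == 0)%:R.
Definition fps_mul F G : fps R := fun n => \sum_(i < n.+1) F i * G (n - i)%N.
Definition fpsX : fps R := fun n => (n == 1)%:R.

Definition fps_trunc n F : {poly R} := \poly_(i < n.+1) F i.

Lemma fps_mul_trunc n F G i :
  (i <= n)%N -> fps_mul F G i = (fps_trunc n F * fps_trunc n G)`_i.
Proof.
move=> le_in; rewrite coefM; apply: eq_bigr => k _; rewrite !coef_poly.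
rewrite !ltnS (leq_trans _ le_in) ?(leq_trans (leq_subr _ _) le_in) //.
by rewrite -ltnS.
Qed.

Lemma fps_mulC : commutative fps_mul.
Proof.
by move=> F G; apply/funext => n; rewrite !(@fps_mul_trunc n) // mulrC.
Qed.

Lemma fps_mulA : associative fps_mul.
Proof.
move=> F G H; apply/funext => n.
transitivity ((fps_trunc n F * fps_trunc n G * fps_trunc n H)`_n).
  rewrite -mulrA coefM; apply: eq_bigr => i _.
  by rewrite coef_poly ltn_ord (@fps_mul_trunc n) // leq_subr.
rewrite coefM; apply: eq_bigr => i _.
by rewrite coef_poly ltnS leq_subr (@fps_mul_trunc n) // -ltnS.
Qed.

Lemma fps_mul1 : left_id fps_one fps_mul.
Proof.
move=> F; apply/funext => n; rewrite /fps_mul big_ord_recl subn0 mul1r.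
by rewrite big1 ?addr0 // => i _; rewrite mul0r.
Qed.

Lemma fps_mulDl : left_distributive fps_mul fps_add.
Proof.
move=> F G H; apply/funext => n; rewrite /fps_mul /fps_add -big_split.
by apply: eq_bigr => i _; rewrite mulrDl.
Qed.

Lemma fps_one_neq0 : fps_one != fps_zero.
Proof. by apply/eqP => /(congr1 (@^~ 0%N)) /eqP; rewrite oner_eq0. Qed.

HB.instance Definition _ := GRing.Zmodule_isComNzRing.Build (fps R)
  fps_mulA fps_mulC fps_mul1 fps_mulDl fps_one_neq0.

Definition fps_unit : {pred fps R} := fun F => F 0%N \is a GRing.unit.

(* Solves F * G = 1 coefficient by coefficient; [fps_inv_rec F n] lists the
   first n coefficients of G. *)
Fixpoint fps_inv_rec F n : seq R :=
  if n isn't m.+1 then [::] else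
  let s := fps_inv_rec F m in
  rcons s ((F 0%N)^-1 * ((m == 0)%:R - \sum_(i < m) s`_i * F (m - i)%N)).

Definition fps_inv F : fps R :=
  if F \in fps_unit then fun n => (fps_inv_rec F n.+1)`_n else F.

Lemma size_fps_inv_rec F n : size (fps_inv_rec F n) = n.
Proof. by elim: n => //= n IHn; rewrite size_rcons IHn. Qed.

Lemma nth_fps_inv_rec F n i :
  (i < n)%N -> (fps_inv_rec F n)`_i = (fps_inv_rec F i.+1)`_i.
Proof.
elim: n => // n IHn; rewrite ltnS leq_eqVlt => /predU1P[-> //|lt_in].
by rewrite [in LHS]/= nth_rcons size_fps_inv_rec lt_in IHn.
Qed.

Lemma fps_mulVx : {in fps_unit, left_inverse 1 fps_inv *%R}.
Proof.
move=> F uF; rewrite /fps_inv uF; apply/funext => n.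
rewrite [LHS]big_ord_recr subnn /= nth_rcons size_fps_inv_rec ltnn eqxx.
rewrite mulrC mulrA mulrV // mul1r addrC.
rewrite [X in _ - X](eq_bigr (fun i : 'I_n =>
  (fps_inv_rec F i.+1)`_i * F (n - i)%N)) ?subrK // => i _.
by rewrite nth_fps_inv_rec.
Qed.

Lemma fps_unitPl F G : G * F = 1 -> fps_unit F.
Proof.
move=> /(congr1 (@^~ 0%N)); rewrite [LHS]big_ord1 => GF1.
by apply/unitrP; exists (G 0%N); rewrite [F 0%N * _]mulrC.
Qed.

Lemma fps_invr_out : {in [predC fps_unit], fps_inv =1 id}.
Proof. by move=> F nuF; rewrite /fps_inv ifN. Qed.

HB.instance Definition _ := GRing.ComNzRing_hasMulInverse.Build (fps R)
  fps_mulVx fps_unitPl fps_invr_out.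

Definition fps_cvg (u : nat -> fps R) F : Prop :=
  forall n, exists N0, forall N, (N0 <= N)%N -> u N n = F n.

(* Equal to 0 if u does not converge. *)
Definition fps_lim (u : nat -> fps R) : fps R := xget 0 (fps_cvg u).

(** [qpoch a b] is (a; b)_oo. *)
Definition qpoch (a b : fps R) : fps R :=
  fps_lim (fun N => \prod_(k < N) (1 - a * b ^+ k)).

Lemma fps_cvg_unique u F G : fps_cvg u F -> fps_cvg u G -> F = G.
Proof.
move=> uF uG; apply/funext => n; have [[N HN] [M HM]] := (uF n, uG n).
by rewrite -(HN _ (leq_maxl N M)) HM // leq_maxr.
Qed.

Lemma fps_lim_cvg u F : fps_cvg u F -> fps_lim u = F.
Proof.
move=> uF; apply: (@fps_cvg_unique u) => //.
by rewrite /fps_lim; apply: (xgetPex 0); exists F.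
Qed.

Lemma fps_mul_eq0_lt m n F :
  (n < m)%N -> (forall i, (i < m)%N -> F i = 0) -> forall G, (F * G) n = 0.
Proof.
move=> ltnm F0 G; apply: big1 => i _; rewrite F0 ?mul0r //.
by apply: leq_trans ltnm; exact: ltn_ord.
Qed.

Lemma fpsXnE m n : (fpsX ^+ m : fps R) n = (n == m)%:R.
Proof.
elim: m n => [|m IHm] n; first by [].
rewrite exprSr; case: n => [|n].
  by rewrite [LHS]big_ord1 mulr0.
rewrite [LHS](bigD1 (Ordinal (leqnSn n.+1))) //= subSn // subnn mulr1 IHm.
rewrite big1 ?addr0 // => i ne_in; rewrite /fpsX; have lt_in := ltn_ord i.
have [|_] := eqVneq; last by rewrite mulr0.
move/eqP; rewrite -(eqn_add2r i) subnK ?(ltnW lt_in) // add1n eqSS => /eqP ei.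
by case/eqP: ne_in; apply: val_inj.
Qed.

Lemma qpochX_cvg m : (0 < m)%N ->
  fps_cvg (fun N => \prod_(k < N) (1 - fpsX ^+ m * (fpsX ^+ m) ^+ k))
    (qpoch (fpsX ^+ m) (fpsX ^+ m)).
Proof.
move=> m0; set u := fun N : nat => _.
have uS n N : (n <= N)%N -> u N n = u n n.
  elim: N => [|N IHN]; first by rewrite leqn0 => /eqP->.
  rewrite leq_eqVlt => /predU1P[-> //|le_nN]; rewrite -IHN //.
  rewrite /u big_ord_recr /= mulrBr mulr1 -exprS -exprM.
  rewrite [LHS](_ : _ = u N n - (u N * fpsX ^+ (m * N.+1)) n) //.
  rewrite [X in _ - X](_ : _ = 0) ?subr0 // mulrC.
  apply: (@fps_mul_eq0_lt (m * N.+1)) => [|i lt_i].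
    by rewrite (leq_trans _ (leq_pmull _ m0)) // ltnS ltnW.
  by rewrite fpsXnE ltn_eqF.
have uu : fps_cvg u (fun n => u n n) by move=> n; exists n => N /uS.
by rewrite /qpoch (fps_lim_cvg uu).
Qed.

Lemma qpochX_unit m :
  (0 < m)%N -> qpoch (fpsX ^+ m) (fpsX ^+ m) \is a GRing.unit.
Proof.
move=> m0; rewrite unfold_in /= /fps_unit.
have [N0 /(_ N0 (leqnn _)) <-] := qpochX_cvg m0 0.
suff -> : (\prod_(k < N0) (1 - fpsX ^+ m * (fpsX ^+ m) ^+ k) : fps R) 0%N = 1.
  exact: unitr1.
elim: N0 => [|N IHN]; first by rewrite big_ord0.
rewrite big_ord_recr [LHS]big_ord1 IHN mul1r -exprS -exprM.
rewrite [LHS](_ : _ = 1 - (fpsX ^+ (m * N.+1) : fps R) 0%N) //.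
by rewrite fpsXnE eq_sym muln_eq0 (gtn_eqF m0) subr0.
Qed.

End FormalPowerSeries.

Arguments fpsX {R}.

Local Close Scope ring_scope.

Definition is_partition (p : seq nat) : bool := sorted geq p && (0 \notin p).

(* {p_i + N - i : 1 <= i <= N}, listed decreasingly; here i starts at 0. *)
Definition beta_set (N : nat) (p : seq nat) : seq nat :=
  [seq nth 0 p i + (N - i.+1) | i <- iota 0 N].

(* X_r = {x : t x + r \in X} *)
Definition runner (t r : nat) (X : seq nat) : seq nat :=
  [seq x %/ t | x <- X & x %% t == r].

(* The parts x_i - (m - i) attached to x_1 > ... > x_m, zeros discarded. *)
Definition partition_of_beta (xs : seq nat) : seq nat :=
  [seq y <- [seq nth 0 xs i - (size xs - i.+1) | i <- iota 0 (size xs)]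
     | 0 < y].

(* The length N of the beta-set may be any multiple of t that is at least the
   number of parts of p; we take N = t * size p. *)
Definition tquotient (t : nat) (p : seq nat) : seq (seq nat) :=
  [seq partition_of_beta (runner t r (beta_set (t * size p) p))
     | r <- iota 0 t].

(* alpha_j(t; p) *)
Definition pretower (t j : nat) (p : seq nat) : seq (seq nat) :=
  iter j (fun ps => flatten [seq tquotient t p' | p' <- ps]) [:: p].

Definition generalized_core (j t : nat) (p : seq nat) : bool :=
  all (fun p' => p' == [::]) (pretower t j.+1 p).

Local Open Scope classical_set_scope.

Definition generalized_cores (j t n : nat) : set (seq nat) :=
  [set p | [/\ is_partition p, sumn p = n & generalized_core j t p]].

(* c_{j,t}(n); [fset_set] is meaningful by [finite_generalized_cores]. *)
Definition num_generalized_cores (j t n : nat) : nat :=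
  #|` fset_set (generalized_cores j t n)|.

Lemma finite_generalized_cores j t n : finite_set (generalized_cores j t n).
Proof.
apply: (@sub_finite_set _ _
  ((fun u : n.-bseq 'I_n.+1 => [seq val x | x <- u]) @` setT)); last first.
  by apply: finite_image; exact: finite_finset.
move=> p [/andP[_ p0] pn _].
have le_n x : x \in p -> x < n.+1.
  move=> xp; rewrite ltnS -pn; elim: p xp {p0 pn} => //= y p IHp.
  by rewrite inE => /predU1P[->|/IHp le_x]; rewrite ?leq_addr ?(leq_trans le_x) ?leq_addl.
have size_p : size p <= n.
  rewrite -pn; elim: p p0 {pn le_n} => //= y p IHp.
  rewrite inE negb_or eq_sym -lt0n => /andP[y0 /IHp le_p].
  by rewrite -add1n leq_add.
have size_u : size (map (@inord n) p) <= n by rewrite size_map.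
exists (Bseq size_u) => //=; rewrite -map_comp -[RHS]map_id.
by apply/esym/seq.eq_in_map => x /le_n xn /=; rewrite inordK.
Qed.

(* Main.v *)
From HB Require Import structures.
Require Import Defs.
From mathcomp Require Import all_boot all_order all_algebra.
From mathcomp Require Import finmap boolp classical_sets functions cardinality.
From mathcomp Require Import zify.

Set Implicit Arguments.
Unset Strict Implicit.
Unset Printing Implicit Defensive.

(** The classical argument sends a partition to its t-core and t-quotient and
    reads off, for the partitions whose quotient components all lie in a class
    S, the generating function C(q) S(q^t)^t, where C counts t-cores.
    Only the ratio of two such formulas matters here, and it has a proof in
    which cores do not appear.  Let gf(S) denote the generating function of the
    partitions in S, let P = gf(all partitions), and let S' be the class of
    partitions whose t-quotient has all its components in S.  Then
    [[
      gf(S')(q) * P(q^t)^t = P(q) * gf(S)(q^t)^t            (quotient_gf)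
    ]]
    because both sides count pairs (partition, t-tuple of partitions), the
    tuple weighing t times its size: exchanging the tuple with the t-quotient
    of the partition is an involution ([swapK]) that preserves the weight
    ([weight_swap]) and exchanges the two families of pairs.

    On beta-sets the exchange is transparent.  A beta-set of p is the disjoint
    union of its t runners.  Replace each runner by the beta-set, with equally
    many elements, of the new component, and reassemble ([graft]).  The sum of
    a beta-set is the size of the partition plus a constant that depends on the
    number of beads only, and t * x + r contributes t * x apart from its
    residue r; so the size of p changes by t times the change in total size of
    the quotient ([sumn_graft]).  A fixed number t * 2n of beads works for all
    the pairs of weight n: then every runner has at least n beads, which is
    room enough for any partition of size at most n.

    A partition has an empty (d+1)-st pre-tower row iff every component of its
    quotient has an empty d-th row.  With P = 1 / (q)_oo ([partition_gf_all]),
    induction on d and the displayed formula give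
    [[
      gf(empty d-th row) * (q)_oo = (q^(t^d); q^(t^d))_oo ^ (t^d),
    ]]
    and the row d = j + 1 is the theorem. *)

(** * Partitions and their beta-sets *)

Lemma beta_set_cons N a p :
  beta_set N.+1 (a :: p) = a + N :: beta_set N p.
Proof.
rewrite /beta_set /= subn1 /= (iotaDl 1 0) -map_comp.
by congr cons; apply: eq_map => i /=; rewrite subSS.
Qed.

Lemma beta_set_nil N : beta_set N.+1 [::] = N :: beta_set N [::].
Proof.
rewrite /beta_set /= subn1 /= (iotaDl 1 0) -map_comp.
by congr cons; apply: eq_map => i /=; rewrite subSS nth_nil.
Qed.

Lemma size_beta_set N p : size (beta_set N p) = N.
Proof. by rewrite size_map size_iota. Qed.

Lemma nth_beta_set N p i :
  i < N -> nth 0 (beta_set N p) i = nth 0 p i + (N - i.+1).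
Proof. by move=> iN; rewrite (nth_map 0) ?size_iota // nth_iota. Qed.

Lemma geq_trans : transitive geq.
Proof. by move=> y x z /= yx zy; exact: leq_trans zy yx. Qed.

Lemma gtn_trans : transitive gtn.
Proof. by move=> y x z /= yx zy; exact: ltn_trans zy yx. Qed.

Lemma nth_sorted_geq p i : sorted geq p -> nth 0 p i.+1 <= nth 0 p i.
Proof.
move=> sp; have [ip|ip] := ltnP i.+1 (size p); last by rewrite nth_default.
by move/(sortedP 0): sp; apply.
Qed.

Lemma sorted_beta_set N p : sorted geq p -> sorted gtn (beta_set N p).
Proof.
move=> sp; apply/(sortedP 0) => i; rewrite size_beta_set => iN.
rewrite !nth_beta_set ?(ltnW iN) //=.
by have := nth_sorted_geq i sp; lia.
Qed.

Lemma sumn_beta_set N p :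
  size p <= N -> sumn (beta_set N p) = sumn p + sumn (beta_set N [::]).
Proof.
elim: N p => [|N IHN] [|a p] //; rewrite ltnS => sp.
by rewrite beta_set_cons beta_set_nil /= IHN // addnACA.
Qed.

(** This is [partition_of_beta] before the zeros are removed; positions in it
    still match positions in the beta-set. *)
Definition beta_parts (xs : seq nat) : seq nat :=
  [seq nth 0 xs i - (size xs - i.+1) | i <- iota 0 (size xs)].

Lemma size_beta_parts xs : size (beta_parts xs) = size xs.
Proof. by rewrite size_map size_iota. Qed.

Lemma nth_beta_parts xs i :
  nth 0 (beta_parts xs) i = nth 0 xs i - (size xs - i.+1).
Proof.
have [ix|ix] := ltnP i (size xs).
  by rewrite (nth_map 0) ?size_iota // nth_iota.
by rewrite !nth_default ?size_beta_parts.
Qed.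

(** Strict decrease leaves room for [size xs - i.+1] distinct smaller naturals
    below the i-th entry.  Hence the truncated subtraction in
    [partition_of_beta] is a true one. *)
Lemma sorted_gtn_nth xs i :
  sorted gtn xs -> size xs - i.+1 <= nth 0 xs i.
Proof.
elim: xs i => //= x xs IHx [|i] sx; last first.
  by rewrite subSS IHx // (path_sorted sx).
rewrite subn1 /=; case: xs IHx sx => //= y xs IHx /andP[yx sx].
by have /= := IHx 0 sx; rewrite subn1 => /leq_ltn_trans; apply.
Qed.

Lemma sorted_beta_parts xs : sorted gtn xs -> sorted geq (beta_parts xs).
Proof.
move=> sx; apply/(sortedP 0) => i; rewrite size_beta_parts => ix.
rewrite !nth_beta_parts /=.
by have /(sortedP 0)/(_ i ix) /= := sx; lia.
Qed.

(** The zeros of a weakly decreasing sequence come last, and the default value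
    of [nth] puts them back after they have been removed. *)
Lemma nth_filter_gt0 p i :
  sorted geq p -> nth 0 [seq y <- p | 0 < y] i = nth 0 p i.
Proof.
elim: p i => //= a p IHp i sp.
have [a0|a_gt0] := posnP a; last first.
  by case: i => //= i; apply: IHp; exact: path_sorted sp.
rewrite {a}a0 in sp *.
have p0 : all (pred1 0) p.
  rewrite (path_sortedE geq_trans) in sp; case/andP: sp => p0 _.
  by apply: sub_all p0 => x /=; rewrite leqn0.
rewrite (@eq_in_filter _ _ pred0) ?filter_pred0 ?nth_nil.
  case: i => //= i; have [ip|ip] := ltnP i (size p).
    by apply/esym/eqP; apply: (all_nthP 0 p0).
  by rewrite nth_default.
by move=> x /(allP p0) /eqP->.
Qed.

Lemma partition_of_beta_is_partition xs :
  sorted gtn xs -> is_partition (partition_of_beta xs).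
Proof.
move=> sx; apply/andP; split; last by rewrite mem_filter.
exact/(sorted_filter geq_trans)/sorted_beta_parts.
Qed.

Lemma size_partition_of_beta xs : size (partition_of_beta xs) <= size xs.
Proof. by rewrite -[leqRHS]size_beta_parts size_filter count_size. Qed.

Lemma partition_of_betaK xs :
  sorted gtn xs -> beta_set (size xs) (partition_of_beta xs) = xs.
Proof.
move=> sx; apply: (@eq_from_nth _ 0); rewrite size_beta_set // => i ix.
rewrite nth_beta_set // nth_filter_gt0 ?sorted_beta_parts // nth_beta_parts.
by rewrite subnK // sorted_gtn_nth.
Qed.

Lemma beta_setK N p :
  is_partition p -> size p <= N -> partition_of_beta (beta_set N p) = p.
Proof.
case/andP=> sp p0 pN.
have -> : partition_of_beta (beta_set N p) =
    [seq y <- p ++ nseq (N - size p) 0 | 0 < y].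
  rewrite /partition_of_beta -/(beta_parts _).
  congr filter; apply: (@eq_from_nth _ 0).
    by rewrite size_beta_parts size_beta_set size_cat size_nseq subnKC.
  move=> i; rewrite size_beta_parts size_beta_set => iN.
  rewrite nth_beta_parts size_beta_set nth_beta_set // addnK nth_cat nth_nseq.
  by case: ltnP => // /(nth_default 0) ->; rewrite if_same.
rewrite filter_cat filter_nseq ltnn cats0; apply/all_filterP/allP => x xp.
by rewrite lt0n; apply: contraNneq p0 => <-.
Qed.

(** Adding t beads to a beta-set acts on each runner by moving its beads up by
    one and adding a bead at 0; such a move is invisible in the partition. *)
Lemma partition_of_beta_shift xs :
  partition_of_beta (rcons (map S xs) 0) = partition_of_beta xs.
Proof.
have -> : partition_of_beta (rcons (map S xs) 0) =
    [seq y <- rcons (beta_parts xs) 0 | 0 < y].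
  rewrite /partition_of_beta -/(beta_parts _).
  congr filter; apply: (@eq_from_nth _ 0).
    by rewrite size_beta_parts !size_rcons size_map size_beta_parts.
  move=> i; rewrite size_beta_parts size_rcons size_map ltnS => ix.
  rewrite nth_beta_parts !nth_rcons size_rcons size_map size_beta_parts.
  have [ix'|_] := ltnP i (size xs); last by case: ifP.
  by rewrite (nth_map 0) // nth_beta_parts; lia.
by rewrite filter_rcons.
Qed.

(** * Runners and the t-quotient *)

Section Runners.
Variable t : nat.
Hypothesis t_gt0 : 0 < t.

Lemma mem_runner r X x : r < t -> (x \in runner t r X) = (t * x + r \in X).
Proof.
move=> rt; apply/mapP/idP => [[y]|xX].
  rewrite mem_filter => /andP[/eqP <- yX] ->.
  by rewrite mulnC -divn_eq.
exists (t * x + r); last by rewrite mulnC divnMDl // divn_small // addn0.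
by rewrite mem_filter xX mulnC modnMDl modn_small ?eqxx.
Qed.

Lemma sorted_runner r X : sorted gtn X -> sorted gtn (runner t r X).
Proof.
move=> sX; pose P := [pred x | x %% t == r].
apply: (homo_sorted_in (P := P) (e := gtn)); last first.
- exact: sorted_filter gtn_trans _ _ sX.
- exact: filter_all.
- move=> x y /eqP xr /eqP yr /=.
  by rewrite {1}(divn_eq y t) {1}(divn_eq x t) xr yr ltn_add2r ltn_pmul2r.
Qed.

Lemma runner_cat r X Y : runner t r (X ++ Y) = runner t r X ++ runner t r Y.
Proof. by rewrite /runner filter_cat map_cat. Qed.

Lemma runner_addr r X :
  runner t r [seq t + x | x <- X] = map S (runner t r X).
Proof.
rewrite /runner filter_map -!map_comp (eq_filter (a2 := fun x => x %% t == r)).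
  by apply: eq_map => x /=; rewrite divnDl ?dvdnn // divnn t_gt0.
by move=> x /=; rewrite modnDl.
Qed.

(** Padding a partition with M zero parts shifts its beta-set by M and adds the
    M least naturals. *)
Lemma beta_set_add M N p : size p <= N ->
  beta_set (M + N) p = [seq M + x | x <- beta_set N p] ++ beta_set M [::].
Proof.
elim: N p => [|N IHN] [|a p] // pN; first by rewrite addn0.
  by rewrite addnS !beta_set_nil IHN.
by rewrite addnS !beta_set_cons IHN //= addnCA.
Qed.

Lemma mem_beta_set_nil N x : (x \in beta_set N [::]) = (x < N).
Proof.
elim: N => [|N IHN] //.
by rewrite beta_set_nil inE IHN [RHS]ltnS [RHS]leq_eqVlt.
Qed.

Lemma runner_beta_set_nil r : r < t -> runner t r (beta_set t [::]) = [:: 0].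
Proof.
move=> rt; apply: (irr_sorted_eq gtn_trans ltnn) => //.
  exact/sorted_runner/sorted_beta_set.
move=> x; rewrite mem_runner // mem_beta_set_nil inE.
case: x => [|x]; first by rewrite muln0.
by rewrite mulnS -addnA ltnNge leq_addr.
Qed.

Lemma runner_beta_set_add r N p : r < t -> size p <= N ->
  runner t r (beta_set (t + N) p) = rcons (map S (runner t r (beta_set N p))) 0.
Proof.
move=> rt pN.
by rewrite beta_set_add // runner_cat runner_addr runner_beta_set_nil // cats1.
Qed.

Definition quotient_part N p r := partition_of_beta (runner t r (beta_set N p)).

Lemma quotient_part_stable r k N p : r < t -> size p <= N ->
  quotient_part (t * k + N) p r = quotient_part N p r.
Proof.
move=> rt pN; elim: k => [|k IHk]; first by rewrite muln0.
rewrite mulnS -addnA /quotient_part.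
rewrite runner_beta_set_add ?(leq_trans pN) ?leq_addl //.
by rewrite partition_of_beta_shift.
Qed.

(** Each block of t beads puts one bead on every runner, so a large beta-set
    leaves room on every runner for a long partition. *)
Lemma size_runner_beta_set r k N p : r < t -> size p <= N ->
  k <= size (runner t r (beta_set (t * k + N) p)).
Proof.
move=> rt pN; elim: k => // k IHk.
rewrite mulnS -addnA runner_beta_set_add ?(leq_trans pN) ?leq_addl //.
by rewrite size_rcons size_map.
Qed.

(** Since the quotient does not depend on the number of beads, a single number
    can serve for many partitions at once. *)
Lemma tquotientE k p : size p <= k ->
  tquotient t p = [seq quotient_part (t * k) p r | r <- iota 0 t].
Proof.
move=> pk; apply/seq.eq_in_map => r; rewrite mem_iota => /= rt.
rewrite -/(quotient_part _ _ _) -(subnK pk) mulnDr quotient_part_stable //.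
exact: leq_pmull.
Qed.

Lemma runner_cons r x X :
  runner t r (x :: X) =
  if x %% t == r then x %/ t :: runner t r X else runner t r X.
Proof. by rewrite /runner /=; case: ifP. Qed.

Lemma size_runners X : size X = \sum_(r < t) size (runner t r X).
Proof.
elim: X => [|x X IHX] /=; first by rewrite big1.
pose r0 := Ordinal (ltn_pmod x t_gt0).
rewrite (eq_bigr (fun r => (if r == r0 then 1 else 0) + size (runner t r X))).
  by rewrite big_split -big_mkcond big_pred1_eq /= IHX.
by move=> r _; rewrite runner_cons -val_eqE eq_sym /=; case: ifP.
Qed.

Lemma sumn_runners X :
  sumn X = \sum_(r < t) (t * sumn (runner t r X) + r * size (runner t r X)).
Proof.
elim: X => [|x X IHX] /=; first by rewrite big1 // => r _; rewrite !muln0.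
pose r0 := Ordinal (ltn_pmod x t_gt0); rewrite IHX.
rewrite [RHS](eq_bigr (fun r : 'I_t => (if r == r0 then x else 0) +
    (t * sumn (runner t r X) + r * size (runner t r X)))).
  by rewrite [RHS]big_split -big_mkcond big_pred1_eq.
move=> r _; rewrite runner_cons -val_eqE eq_sym /=.
by case: eqP => // -> /=; have := divn_eq x t; lia.
Qed.

(** * Replacing the quotient of a partition *)

(** The inverse of the splitting into runners. Sorting without duplicates makes
    the result strictly decreasing whatever the runners are. *)
Definition merge_runners (Y : nat -> seq nat) : seq nat :=
  sort geq
    (undup (flatten [seq [seq t * x + r | x <- Y r] | r <- iota 0 t])).

Lemma mem_merge_runners Y x :
  (x \in merge_runners Y) = (x %/ t \in Y (x %% t)).
Proof.
rewrite mem_sort mem_undup; apply/flatten_mapP/idP => [[r]|xY].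
  rewrite mem_iota => /= rt /mapP[y yY ->].
  by rewrite mulnC modnMDl divnMDl // divn_small // addn0 modn_small.
exists (x %% t); first by rewrite mem_iota ltn_pmod.
by apply/mapP; exists (x %/ t) => //; rewrite mulnC -divn_eq.
Qed.

Lemma sorted_merge_runners Y : sorted gtn (merge_runners Y).
Proof.
by rewrite gtn_sorted_uniq_geq sort_uniq undup_uniq sort_sorted.
Qed.

Lemma runner_merge_runners Y r :
  r < t -> sorted gtn (Y r) -> runner t r (merge_runners Y) = Y r.
Proof.
move=> rt sY; apply: (irr_sorted_eq gtn_trans ltnn) => //.
  exact/sorted_runner/sorted_merge_runners.
move=> x; rewrite mem_runner // mem_merge_runners mulnC modnMDl divnMDl //.
by rewrite divn_small // addn0 modn_small.
Qed.

Lemma merge_runnersK X Y : sorted gtn X ->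
  (forall r, r < t -> Y r = runner t r X) -> merge_runners Y = X.
Proof.
move=> sX YX; apply: (irr_sorted_eq gtn_trans ltnn) => //.
  exact: sorted_merge_runners.
move=> x; have rt := ltn_pmod x t_gt0.
by rewrite mem_merge_runners YX // mem_runner // mulnC -divn_eq.
Qed.

Definition runner_size N p r := size (runner t r (beta_set N p)).

(** [graft N p mu] has the t-core of p and the t-quotient mu.  Keeping the
    number of beads on each runner is what preserves the core. *)
Definition graft N p mu :=
  partition_of_beta
    (merge_runners (fun r => beta_set (runner_size N p r) (mu r))).

Section Graft.
Variables (N : nat) (p : seq nat) (mu : nat -> seq nat).
Hypothesis p_partition : is_partition p.
Hypothesis size_p : size p <= N.
Hypothesis mu_partition : forall r, r < t -> is_partition (mu r).
Hypothesis size_mu : forall r, r < t -> size (mu r) <= runner_size N p r.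

Lemma quotient_part_is_partition r : is_partition (quotient_part N p r).
Proof.
apply/partition_of_beta_is_partition/sorted_runner/sorted_beta_set.
by case/andP: p_partition.
Qed.

Lemma graft_is_partition : is_partition (graft N p mu).
Proof. exact/partition_of_beta_is_partition/sorted_merge_runners. Qed.

Lemma runner_graft_beta r : r < t ->
  runner t r (merge_runners (fun r => beta_set (runner_size N p r) (mu r))) =
  beta_set (runner_size N p r) (mu r).
Proof.
move=> rt; rewrite runner_merge_runners // sorted_beta_set //.
by case/andP: (mu_partition rt).
Qed.

(** The new beta-set again has N elements, because each runner keeps its number
    of beads; hence the same N can be used to operate on the result. *)
Lemma beta_set_graft : beta_set N (graft N p mu) =
  merge_runners (fun r => beta_set (runner_size N p r) (mu r)).
Proof.
set X := merge_runners _; suff sX : size X = N.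
  by rewrite -{1}sX partition_of_betaK //; exact: sorted_merge_runners.
rewrite size_runners -[RHS](size_beta_set N p) size_runners.
by apply: eq_bigr => r _; rewrite runner_graft_beta // size_beta_set.
Qed.

Lemma size_graft : size (graft N p mu) <= N.
Proof.
apply: leq_trans (size_partition_of_beta _) _.
by rewrite -beta_set_graft size_beta_set.
Qed.

Lemma quotient_part_graft r : r < t -> quotient_part N (graft N p mu) r = mu r.
Proof.
move=> rt; rewrite /quotient_part beta_set_graft runner_graft_beta //.
by rewrite beta_setK ?mu_partition ?size_mu.
Qed.

(** The second graft sees runners of the same sizes as those of p, so putting
    back the components of p restores its runners. *)
Lemma graftK nu : (forall r, r < t -> nu r = quotient_part N p r) ->
  graft N (graft N p mu) nu = p.
Proof.
move=> nuE; have sp : sorted gtn (beta_set N p).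
  by apply: sorted_beta_set; case/andP: p_partition.
rewrite {1}/graft (@merge_runnersK (beta_set N p)) ?beta_setK // => r rt.
rewrite /runner_size beta_set_graft runner_graft_beta // size_beta_set nuE //.
exact/partition_of_betaK/sorted_runner.
Qed.

(** Runner by runner: both beta-sets have equally many beads in total and on
    each runner, so the constants relating sums of beads to sums of parts
    cancel, as do the contributions of the residues. *)
Lemma sumn_graft :
  sumn (graft N p mu) + t * \sum_(r < t) sumn (quotient_part N p r) =
  sumn p + t * \sum_(r < t) sumn (mu r).
Proof.
apply: (@addIn (sumn (beta_set N [::]))).
rewrite addnAC -sumn_beta_set ?size_graft //.
rewrite [RHS]addnAC -sumn_beta_set // beta_set_graft 2!sumn_runners.
rewrite !big_distrr /= -!big_split /=; apply: eq_bigr => r _.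
rewrite runner_graft_beta // size_beta_set sumn_beta_set ?size_mu //.
have sX : sorted gtn (runner t r (beta_set N p)).
  by apply/sorted_runner/sorted_beta_set; case/andP: p_partition.
rewrite -{1}(partition_of_betaK sX) (sumn_beta_set (size_partition_of_beta _)).
by rewrite -!/(runner_size _ _ _) -/(quotient_part _ _ _); lia.
Qed.

End Graft.
End Runners.

(** * Formal power series modulo q^(n+1) and the substitution of q^t for q *)

Import GRing.Theory.
Local Open Scope ring_scope.

Section PowerSeries.
Variable R : comUnitRingType.
Implicit Types F G : fps R.

Definition fps_eq_upto n F G := forall i, (i <= n)%N -> F i = G i.

Lemma fps_eq_uptoM n F F' G G' : fps_eq_upto n F F' -> fps_eq_upto n G G' ->
  fps_eq_upto n (F * G) (F' * G').
Proof.
move=> eF eG i le_in; apply: eq_bigr => k _.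
rewrite eF ?eG //; first by rewrite (leq_trans (leq_subr _ _)).
by apply: leq_trans le_in; rewrite -ltnS.
Qed.

Lemma fps_eq_uptoX n F F' m :
  fps_eq_upto n F F' -> fps_eq_upto n (F ^+ m) (F' ^+ m).
Proof.
by move=> eF; elim: m => // m IHm; rewrite !exprS; exact: fps_eq_uptoM.
Qed.

Lemma fps_coef_sum I (r : seq I) (P : pred I) (F : I -> fps R) n :
  (\sum_(i <- r | P i) F i) n = \sum_(i <- r | P i) F i n.
Proof. exact: (big_morph (fun F : fps R => F n)). Qed.

Lemma fps_coefXnM k F n :
  (fpsX ^+ k * F) n = if (k <= n)%N then F (n - k)%N else 0.
Proof.
rewrite [LHS](eq_bigr (fun i : 'I_n.+1 =>
    if i == k :> nat then F (n - k)%N else 0)).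
  rewrite -big_mkcond /=; case: ifP => [kn|/negbT kn].
    by rewrite (big_pred1 (Ordinal (kn : k < n.+1)%N)).
  rewrite big_pred0 // => i; apply: contraNF kn => /eqP <-.
  by rewrite -ltnS.
by move=> i _; rewrite fpsXnE; case: eqP => [->|]; rewrite ?mul1r ?mul0r.
Qed.

(** Coefficientwise convergence is uniform on the finitely many coefficients up
    to n, which lets a product with a limit be computed at a finite stage. *)
Lemma fps_cvg_upto u F n : fps_cvg u F ->
  exists N0, forall N, (N0 <= N)%N -> fps_eq_upto n (u N) F.
Proof.
move=> uF; elim: n => [|n [N0 IHn]].
  have [N0 HN] := uF 0%N.
  by exists N0 => N /HN HNn i; rewrite leqn0 => /eqP->.
have [N1 HN1] := uF n.+1; exists (maxn N0 N1) => N.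
rewrite geq_max => /andP[/IHn HN0 /HN1 HN] i.
by rewrite leq_eqVlt => /predU1P[-> //|]; exact: HN0.
Qed.

Section Subst.
Variable t : nat.
Hypothesis t_gt0 : (0 < t)%N.

Definition fps_subst F : fps R :=
  fun n => if (t %| n)%N then F (n %/ t)%N else 0.

(** On truncations the substitution is composition of polynomials, from which
    it inherits multiplicativity. *)
Lemma fps_substE F n i : (i <= n)%N ->
  fps_subst F i = (fps_trunc n F \Po 'X^t)`_i.
Proof.
move=> le_in; rewrite coef_comp_poly_Xn // coef_poly ltnS.
by rewrite (leq_trans (leq_div _ _)).
Qed.

Lemma fps_subst1 : fps_subst 1 = 1.
Proof.
apply/funext => n; rewrite /fps_subst; case: ifP => [/dvdnP[k ->]|tn].
  rewrite mulnK //; congr (_%:R : R).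
  by rewrite /= muln_eq0 (gtn_eqF t_gt0) orbF.
by case: n tn => //; rewrite dvdn0.
Qed.

Lemma fps_substM F G : fps_subst (F * G) = fps_subst F * fps_subst G.
Proof.
apply/funext => n; rewrite [RHS](eq_bigr (fun i : 'I_n.+1 =>
    (fps_trunc n F \Po 'X^t)`_i * (fps_trunc n G \Po 'X^t)`_(n - i)%N)).
  rewrite -coefM -comp_polyM coef_comp_poly_Xn // /fps_subst; case: ifP => // _.
  exact/fps_mul_trunc/leq_div.
by move=> i _; rewrite -!fps_substE ?leq_subr // -ltnS.
Qed.

Lemma fps_substX F m : fps_subst (F ^+ m) = fps_subst F ^+ m.
Proof.
by elim: m => [|m IHm]; rewrite ?fps_subst1 // !exprS fps_substM IHm.
Qed.

Lemma fps_substB F G : fps_subst (F - G) = fps_subst F - fps_subst G.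
Proof.
apply/funext => n; rewrite [RHS](_ : _ = fps_subst F n - fps_subst G n) //.
by rewrite /fps_subst; case: ifP; rewrite ?subr0.
Qed.

Lemma fps_subst_fpsXn m : fps_subst (fpsX ^+ m) = fpsX ^+ (t * m).
Proof.
apply/funext => n; rewrite /fps_subst !fpsXnE; case: ifP => [/dvdnP[k ->]|].
  by rewrite mulnK // mulnC eqn_pmul2l.
by case: eqP => // ->; rewrite dvdn_mulr.
Qed.

Lemma fps_subst_qpoch m : (0 < m)%N ->
  fps_subst (qpoch (fpsX ^+ m) (fpsX ^+ m)) =
  qpoch (fpsX ^+ (t * m)) (fpsX ^+ (t * m)).
Proof.
move=> m_gt0; apply/esym/fps_lim_cvg => n.
have substP N : \prod_(k < N) (1 - fpsX ^+ (t * m) * (fpsX ^+ (t * m)) ^+ k) =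
    fps_subst (\prod_(k < N) (1 - fpsX ^+ m * (fpsX ^+ m) ^+ k)).
  rewrite (big_morph _ fps_substM fps_subst1); apply: eq_bigr => k _.
  by rewrite fps_substB fps_subst1 -!exprS -!exprM fps_subst_fpsXn mulnA.
have [N0 HN] := qpochX_cvg R m_gt0 (n %/ t)%N.
by exists N0 => N /HN HNn; rewrite substP /fps_subst HNn.
Qed.

End Subst.
End PowerSeries.

(** * Generating functions of classes of partitions *)

Section GeneratingFunctions.
Variable R : comUnitRingType.

Local Open Scope classical_set_scope.

Definition partitions (S : pred (seq nat)) (n : nat) : set (seq nat) :=
  [set p | [/\ is_partition p, sumn p = n & S p]].

Definition partition_gf (S : pred (seq nat)) : fps R :=
  fun n => #|` fset_set (partitions S n)|%:R.

Lemma finite_partitions S n : finite_set (partitions S n).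
Proof.
(* For t = 0 the quotient is the empty tuple, so that every partition of n is
   a generalized core. *)
apply: sub_finite_set (finite_generalized_cores 0 0 n) => p [p_part pn _].
by split.
Qed.

Lemma size_leq_sumn p : is_partition p -> (size p <= sumn p)%N.
Proof.
case/andP=> _; elim: p => //= a p IHp; rewrite inE => /norP[a0 /IHp].
by case: a a0 => // a _ le_p; rewrite addSn ltnS (leq_trans le_p) ?leq_addl.
Qed.

Definition partitions_upto (n : nat) : set (seq nat) :=
  [set p | is_partition p /\ (sumn p <= n)%N].

Lemma finite_partitions_upto n : finite_set (partitions_upto n).
Proof.
apply: (@sub_finite_set _ _ (\bigcup_(i in `I_n.+1) partitions xpredT i)).
  by move=> p [p_part pn]; exists (sumn p).
by apply: bigcup_finite => // i _; exact: finite_partitions.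
Qed.

Definition partition_fset n : {fset seq nat} := fset_set (partitions_upto n).

Lemma mem_partition_fset n p :
  (p \in partition_fset n) = is_partition p && (sumn p <= n)%N.
Proof.
rewrite in_fset_set; last exact: finite_partitions_upto.
by apply/idP/andP; rewrite inE.
Qed.

Lemma mem_partitions S n p :
  (p \in fset_set (partitions S n)) = [&& is_partition p, sumn p == n & S p].
Proof.
rewrite in_fset_set; last exact: finite_partitions.
by apply/idP/and3P; rewrite inE => -[? /eqP ? ?]; split.
Qed.

Lemma partition_gf_coef S n i : (i <= n)%N ->
  partition_gf S i =
  \sum_(p : partition_fset n | S (val p)) (i == sumn (val p))%:R.
Proof.
move=> le_in; rewrite -(big_seq_fsetE _ _ S (fun p => (i == sumn p)%:R)) /=.
rewrite [RHS](eq_bigr (fun p => if i == sumn p then 1 else 0)); last first.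
  by move=> p _; case: ifP.
rewrite -big_mkcondr /= -big_filter /partition_gf card_fset_sum1 natr_sum.
apply: perm_big; apply: uniq_perm; rewrite ?filter_uniq ?fset_uniq // => p.
rewrite mem_partitions mem_filter mem_partition_fset eq_sym.
by case: eqP => [<-|]; rewrite ?le_in ?andbF ?andbT //= andbC.
Qed.

(** A finite sum of monomials, unlike [partition_gf S] itself, can be expanded
    by distributivity when it is raised to a power. *)
Lemma partition_gf_trunc S n :
  fps_eq_upto n (partition_gf S)
    (\sum_(p : partition_fset n | S (val p)) fpsX ^+ sumn (val p)).
Proof.
move=> i le_in; rewrite fps_coef_sum (partition_gf_coef S le_in).
by apply: eq_bigr => p _; rewrite fpsXnE.
Qed.

Lemma partition_gf_subst_trunc t S n : (0 < t)%N ->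
  fps_eq_upto n (fps_subst t (partition_gf S))
    (\sum_(p : partition_fset n | S (val p)) fpsX ^+ (t * sumn (val p))).
Proof.
move=> t_gt0 i le_in; rewrite fps_coef_sum /fps_subst.
rewrite (partition_gf_coef S (leq_trans (leq_div _ _) le_in)).
case: ifP => [/dvdnP[k ->]|ti].
  apply: eq_bigr => p _.
  by rewrite fpsXnE mulnK // mulnC eqn_pmul2l.
rewrite big1 // => p _; rewrite fpsXnE.
by case: eqP ti => // ->; rewrite dvdn_mulr.
Qed.

(** The partitions in a pair of weight n have size at most n, so the pairs of
    weight n all live in this finite type, where they can be counted. *)
Definition tuple_pair t n : finType :=
  (partition_fset n * {ffun 'I_t -> partition_fset n})%type.

Definition weight t n (x : tuple_pair t n) : nat :=
  (sumn (val x.1) + t * \sum_(r < t) sumn (val (x.2 r)))%N.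

Definition quotient_pairs t n (A S : pred (seq nat)) :
    {pred tuple_pair t n} :=
  [pred x : tuple_pair t n |
    [&& A (val x.1), [forall r, S (val (x.2 r))] & weight x == n]].

(** Expanding the product of the truncated sums gives one monomial for each
    pair, whose exponent is the weight. *)
Lemma quotient_pairs_coef t n A S : (0 < t)%N ->
  (partition_gf A * fps_subst t (partition_gf S) ^+ t) n =
  #|@quotient_pairs t n A S|%:R.
Proof.
move=> t_gt0.
rewrite (fps_eq_uptoM (partition_gf_trunc A (n := n))
  (fps_eq_uptoX t (partition_gf_subst_trunc S (n := n) t_gt0))) //.
rewrite -[t in _ ^+ t]card_ord -prodr_const bigA_distr_big big_distrlr /=.
rewrite pair_big_dep /= fps_coef_sum -sum1_card natr_sum.
rewrite [RHS](eq_bigl (fun x : tuple_pair t n =>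
  (A (val x.1) && (x.2 \in ffun_on (fun y => S (val y)))) && (n == weight x))).
  rewrite [RHS]big_mkcondr /=; apply: eq_bigr => x _.
  rewrite -expr_sum -exprD -big_distrr fpsXnE /=.
  by case: ifP.
by move=> x; rewrite inE -andbA eq_sym.
Qed.

(** A partition with parts at most m + 1 either has parts at most m, or starts
    with m + 1 and stays of the same kind when that part is removed. *)
Lemma partitions_consE m n :
  (fset_set (partitions (all (leq^~ m.+1)) (m.+1 + n)) =
   fset_set (partitions (all (leq^~ m)) (m.+1 + n)) `|`
   [fset (m.+1 :: p)%SEQ | p in
     fset_set (partitions (all (leq^~ m.+1)) n)])%fset.
Proof.
apply/fsetP => p; rewrite in_fsetU !mem_partitions.
apply/idP/orP => [/and3P[p_part pn]|[/and3P[-> -> pm]|/imfsetP[q /=]]].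
- case: p p_part pn => [|a p]; first by left; apply/and3P.
  move=> p_part pn /= /andP[am pm]; rewrite leq_eqVlt in am.
  case/andP: p_part; rewrite /= (path_sortedE geq_trans) inE.
  move=> /andP[pa p_sorted] /norP[a0 p0].
  case/predU1P: am => [a_eq|am]; [right|left].
    apply/imfsetP; exists p; last by rewrite a_eq.
    rewrite /= mem_partitions pm /is_partition p_sorted p0 /=.
    by move: pn; rewrite /= a_eq eqn_add2l andbT.
  apply/and3P; split=> //.
    rewrite /is_partition /= (path_sortedE geq_trans) pa p_sorted.
    by rewrite inE negb_or a0.
  rewrite ltnS in am; rewrite /= am.
  by apply: sub_all pa => x /= /leq_trans; apply.
- by apply: sub_all pm => x /leqW.
- rewrite mem_partitions => /and3P[/andP[q_sorted q0] qn qm] ->.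
  rewrite /is_partition /= (path_sortedE geq_trans) qm q_sorted inE q0.
  by rewrite eqn_add2l qn leqnn.
Qed.

Lemma partition_gf_bounded_step m :
  partition_gf (all (leq^~ m.+1)) =
  partition_gf (all (leq^~ m)) + fpsX ^+ m.+1 * partition_gf (all (leq^~ m.+1)).
Proof.
apply/funext => n.
rewrite [RHS](_ : _ = partition_gf (all (leq^~ m)) n +
  (fpsX ^+ m.+1 * partition_gf (all (leq^~ m.+1))) n) // fps_coefXnM.
case: ifP => [mn|/negbT nm].
  rewrite {1 2}/partition_gf -{1 2}(subnKC mn) partitions_consE -natrD.
  rewrite cardfsU [(_ `&` _)%fset](_ : _ = fset0)%fset ?cardfs0 ?subn0.
    by rewrite card_imfset // => x y [].
  apply/fsetP => p; rewrite in_fsetI mem_partitions in_fset0.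
  apply/negP => /andP[/and3P[_ _ pm] /imfsetP[q _ pq]].
  by move: pm; rewrite pq /= ltnn.
rewrite addr0 /partition_gf; congr (_%:R : R); congr #|` _|.
apply/fsetP => p; rewrite !mem_partitions; apply: andb_id2l => p_part.
apply: andb_id2l => /eqP pn; apply/allP/allP => pm x xp; last exact/leqW/pm.
have := perm_sumn (perm_to_rem xp); rewrite pn /=; lia.
Qed.

Lemma partition_gf_nil (S : pred (seq nat)) :
  S [::] -> (forall p, is_partition p -> S p -> p = [::]) ->
  partition_gf S = 1.
Proof.
move=> S0 Snil; apply/funext => n; congr (_%:R : R).
case: eqP => [->|/eqP n0] /=.
  rewrite (_ : fset_set _ = [fset [::]])%fset ?cardfs1 //.
  apply/fsetP => p; rewrite mem_partitions inE.
  by apply/and3P/eqP => [[p_part _ /(Snil _ p_part)]|->].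
rewrite (_ : fset_set _ = fset0)%fset ?cardfs0 //.
apply/fsetP => p; rewrite mem_partitions inE.
apply/and3P => -[p_part /eqP pn /(Snil _ p_part) p0].
by rewrite -pn p0 in n0.
Qed.

(** By the recurrence above, allowing the part m + 1 divides the generating
    function by 1 - q^(m+1). *)
Lemma partition_gf_bounded m :
  partition_gf (all (leq^~ m)) * \prod_(k < m) (1 - fpsX * fpsX ^+ k) = 1.
Proof.
elim: m => [|m IHm].
  rewrite big_ord0 mulr1 partition_gf_nil // => -[|a p] //= /andP[_].
  by rewrite inE leqn0 => /norP[a0 _] /andP[/eqP a_eq]; rewrite a_eq in a0.
rewrite big_ord_recr /= mulrCA mulrBr mulr1 -exprS.
rewrite [X in _ * (X - _)]partition_gf_bounded_step [_ * fpsX ^+ _]mulrC addrK.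
by rewrite mulrC.
Qed.

(** Up to degree n, allowing only parts at most N >= n changes nothing, so
    Euler's product formula follows from its bounded version. *)
Lemma partition_gf_all : partition_gf xpredT * qpoch fpsX fpsX = 1.
Proof.
rewrite -[fpsX]expr1; apply/funext => n.
have [N0 HN] := fps_cvg_upto n (qpochX_cvg R (ltn0Sn 0)).
pose N := maxn N0 n; rewrite -[RHS](congr1 (@^~ n) (partition_gf_bounded N)).
apply: fps_eq_uptoM (leqnn n) => i le_in; last first.
  by rewrite -(HN N) ?leq_maxl // expr1.
congr (_%:R : R); congr #|` _|; apply/fsetP => p; rewrite !mem_partitions.
rewrite andbT; case: eqP => [pi|_]; rewrite ?andbF // andbT.
rewrite [X in _ && X](_ : _ = true) ?andbT //; apply/allP => x xp.
have := perm_sumn (perm_to_rem xp); rewrite pi /= => i_eq.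
by rewrite (leq_trans _ (leq_maxr _ _)) // (leq_trans _ le_in) // i_eq leq_addr.
Qed.

End GeneratingFunctions.

(** * The involution on pairs *)

Section Swap.
Local Open Scope nat_scope.
Variables (t n : nat).
Hypothesis t_gt0 : 0 < t.

Local Notation pairs := (tuple_pair t n).
Local Notation N := (t * (n + n))%N.

(** [graft] takes tuples indexed by naturals, of which it reads the first t
    entries. *)
Definition component (x : pairs) (r : nat) : seq nat :=
  if insub r is Some i then val (x.2 i) else [::].

Lemma componentE (x : pairs) (r : 'I_t) : component x r = val (x.2 r).
Proof. by rewrite /component valK. Qed.

(** On pairs of weight n both constructions stay within size n ([val_swap1] and
    [val_swap2]), so that [insubd] only attaches the bound to them. *)
Definition swap (x : pairs) : pairs :=
  (insubd x.1 (graft t N (val x.1) (component x)),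
   [ffun r => insubd (x.2 r) (quotient_part t N (val x.1) r)]).

Section SwapProperties.
Variable x : pairs.
Hypothesis weight_x : weight x = n.

Let p_part : is_partition (val x.1).
Proof. by have := valP x.1; rewrite mem_partition_fset => /andP[]. Qed.

Let size_p : size (val x.1) <= n.
Proof.
have := valP x.1; rewrite mem_partition_fset => /andP[pp].
exact/leq_trans/size_leq_sumn.
Qed.

Let mu_part r : r < t -> is_partition (component x r).
Proof.
move=> rt; rewrite -[r]/(val (Ordinal rt)) componentE.
by have := valP (x.2 (Ordinal rt)); rewrite mem_partition_fset => /andP[].
Qed.

Let size_p_t : size (val x.1) <= t * n.
Proof. exact: leq_trans size_p (leq_pmull _ t_gt0). Qed.

Let size_p_N : size (val x.1) <= N.
Proof. by rewrite mulnDr (leq_trans size_p_t) ?leq_addl. Qed.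

Let size_mu r : r < t -> size (component x r) <= runner_size t N (val x.1) r.
Proof.
move=> rt; apply: (@leq_trans n); last first.
  by rewrite mulnDr; exact: size_runner_beta_set.
rewrite -[r]/(val (Ordinal rt)) componentE.
have := valP (x.2 (Ordinal rt)); rewrite mem_partition_fset => /andP[pp].
exact/leq_trans/size_leq_sumn.
Qed.

(** By [sumn_graft] the size of the graft plus t times the size of the old
    quotient is the weight n, which bounds both terms. *)
Lemma val_swap1 : val (swap x).1 = graft t N (val x.1) (component x).
Proof.
rewrite insubdK // -topredE /= mem_partition_fset graft_is_partition //=.
have := sumn_graft t_gt0 p_part size_p_N mu_part size_mu.
rewrite [in RHS](eq_bigr (fun r => sumn (val (x.2 r)))); last first.
  by move=> r _; rewrite componentE.
rewrite -/(weight x) weight_x => graft_eq.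
by rewrite -[leqRHS]graft_eq leq_addr.
Qed.

Lemma val_swap2 r : val ((swap x).2 r) = quotient_part t N (val x.1) r.
Proof.
rewrite ffunE insubdK // -topredE /= mem_partition_fset.
rewrite quotient_part_is_partition //=.
have := sumn_graft t_gt0 p_part size_p_N mu_part size_mu.
rewrite [in RHS](eq_bigr (fun r => sumn (val (x.2 r)))); last first.
  by move=> i _; rewrite componentE.
rewrite -/(weight x) weight_x => graft_eq.
rewrite -[leqRHS]graft_eq (leq_trans _ (leq_addl _ _)) //.
by rewrite (leq_trans _ (leq_pmull _ t_gt0)) // (bigD1 r) //= leq_addr.
Qed.

Lemma component_swap r : r < t ->
  component (swap x) r = quotient_part t N (val x.1) r.
Proof. by move=> rt; rewrite -[r]/(val (Ordinal rt)) componentE val_swap2. Qed.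

Lemma quotient_part_swap r : r < t ->
  quotient_part t N (val (swap x).1) r = component x r.
Proof. by move=> rt; rewrite val_swap1 quotient_part_graft. Qed.

Lemma weight_swap : weight (swap x) = n.
Proof.
rewrite -[RHS]weight_x /weight val_swap1.
rewrite (eq_bigr _ (fun r _ => congr1 sumn (val_swap2 r))).
rewrite sumn_graft //; congr (_ + t * _).
by apply: eq_bigr => r _; rewrite componentE.
Qed.

Lemma graft_swap : graft t N (val (swap x).1) (component (swap x)) = val x.1.
Proof. by rewrite val_swap1 graftK //; exact: component_swap. Qed.

End SwapProperties.

Lemma swapK x : weight x = n -> swap (swap x) = x.
Proof.
move=> wx; have wsx := weight_swap wx.
rewrite [LHS]surjective_pairing [RHS]surjective_pairing; congr pair.
  by apply: val_inj; rewrite val_swap1 // graft_swap.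
apply/ffunP => r; apply: val_inj.
by rewrite val_swap2 // quotient_part_swap // componentE.
Qed.

Lemma all_tquotientE (S : pred (seq nat)) (p : partition_fset n) :
  all S (tquotient t (val p)) =
  [forall r : 'I_t, S (quotient_part t N (val p) r)].
Proof.
rewrite (@tquotientE _ t_gt0 (n + n)); last first.
  have := valP p; rewrite mem_partition_fset => /andP[/size_leq_sumn pp pn].
  by rewrite (leq_trans pp) // (leq_trans pn) // leq_addl.
apply/allP/forallP => [Sq r|Sq q /mapP[r]].
  by apply/Sq/map_f; rewrite mem_iota /=.
by rewrite mem_iota => /= rt ->; exact: (Sq (Ordinal rt)).
Qed.

(** Cancellation makes [swap] injective on any set of pairs of weight n. *)
Lemma leq_card_swap (A B : {pred pairs}) :
  {in A, forall x, weight x = n} -> {in A, forall x, swap x \in B} ->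
  #|A| <= #|B|.
Proof.
move=> wA AB; have swap_inj : {in A &, injective swap}.
  by move=> x y /wA/swapK xK /wA/swapK yK sxy; rewrite -xK sxy yK.
rewrite -(card_in_image swap_inj); apply/subset_leq_card/fintype.subsetP => y.
by case/fintype.imageP => x xA ->; exact: AB.
Qed.

Lemma card_quotient_pairs (S : pred (seq nat)) :
  #|@quotient_pairs t n (fun p => all S (tquotient t p)) xpredT| =
  #|@quotient_pairs t n xpredT S|.
Proof.
apply/eqP; rewrite eqn_leq !leq_card_swap // => x; rewrite !unfold_in.
- by case/and3P=> _ _ /eqP.
- case/and3P=> _ /forallP Sx /eqP wx.
  apply/and3P; split; last by rewrite weight_swap.
    rewrite all_tquotientE; apply/forallP => r.
    by rewrite quotient_part_swap // componentE.
  exact/forallP.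
- by case/and3P=> _ _ /eqP.
- case/and3P; rewrite all_tquotientE => /forallP Sx _ /eqP wx.
  apply/and3P; split=> //; last by rewrite weight_swap.
  by apply/forallP => r; rewrite val_swap2.
Qed.

End Swap.

(** * Rows of the pre-tower *)

Section Cores.
Variables (R : comUnitRingType) (t : nat).
Hypothesis t_gt0 : (0 < t)%N.
Local Notation gf := (partition_gf R).

Lemma quotient_gf (S : pred (seq nat)) :
  gf (fun p => all S (tquotient t p)) * fps_subst t (gf xpredT) ^+ t =
  gf xpredT * fps_subst t (gf S) ^+ t.
Proof.
by apply/funext => n; rewrite !quotient_pairs_coef // card_quotient_pairs.
Qed.

Definition pretower_row_empty d p := all (fun q => q == [::]) (pretower t d p).

Lemma iter_tquotient d ps :
  iter d (fun ps => flatten [seq tquotient t p | p <- ps]) ps =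
  flatten [seq pretower t d p | p <- ps].
Proof.
elim: d ps => [|d IHd] ps.
  by rewrite /pretower /=; elim: ps => //= p ps <-.
have pretowerS p : pretower t d.+1 p =
    flatten [seq pretower t d q | q <- tquotient t p].
  by rewrite {1}/pretower iterSr IHd /= cats0.
rewrite iterSr IHd (eq_map pretowerS); elim: ps => //= p ps IHps.
by rewrite map_cat flatten_cat IHps.
Qed.

Lemma pretower_row_emptyS d p :
  pretower_row_empty d.+1 p = all (pretower_row_empty d) (tquotient t p).
Proof.
rewrite /pretower_row_empty {1}/pretower iterSr iter_tquotient /= cats0.
by elim: (tquotient t p) => //= q qs IHq; rewrite all_cat IHq.
Qed.

(** Substituting q^t in the formula for d and raising it to the power t gives
    the right-hand side of [quotient_gf], up to the factors P and P(q^t)^t, which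
    are 1 / (q)_oo and 1 / (q^t; q^t)_oo^t by Euler's formula. *)
Lemma pretower_row_empty_gf d :
  gf (pretower_row_empty d) * qpoch fpsX fpsX =
  qpoch (fpsX ^+ (t ^ d)) (fpsX ^+ (t ^ d)) ^+ (t ^ d).
Proof.
elim: d => [|d IHd].
  rewrite partition_gf_nil ?mul1r ?expr1 // => p _.
  by rewrite /pretower_row_empty /= andbT => /eqP.
have -> : pretower_row_empty d.+1 =
    (fun p => all (pretower_row_empty d) (tquotient t p)).
  by apply/funext => p; exact: pretower_row_emptyS.
have substE :
    fps_subst t (qpoch fpsX fpsX) = qpoch (fpsX ^+ t) (fpsX ^+ t) :> fps R.
  by rewrite -[fpsX]expr1 fps_subst_qpoch // muln1 expr1.
have /(congr1 (fps_subst t)) := partition_gf_all R.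
rewrite fps_substM // substE fps_subst1 // => PE.
move/(congr1 (fps_subst t)): IHd.
rewrite fps_substM // substE fps_substX // fps_subst_qpoch ?expn_gt0 ?t_gt0 //.
rewrite -expnS => SE.
rewrite -[LHS]mulr1 -[X in _ * X](expr1n _ t) -PE exprMn mulrACA quotient_gf.
rewrite mulrACA partition_gf_all mul1r -exprMn SE -exprM.
by rewrite expnSr.
Qed.
End Cores.

Theorem corollary1p4 (t j : nat) (t_ge2 : (2 <= t)%N) :
  ((fun n => (num_generalized_cores j t n)%:R) : fps int) =
  qpoch (fpsX ^+ (t ^ j.+1)) (fpsX ^+ (t ^ j.+1)) ^+ (t ^ j.+1)
    / qpoch fpsX fpsX.
Proof.
have E_unit : qpoch fpsX fpsX \is a @GRing.unit (fps int).
  by rewrite -[fpsX]expr1 qpochX_unit.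
by rewrite -(pretower_row_empty_gf int (ltnW t_ge2)) mulrK.
Qed.
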